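(* Let $(X,d)$ be a metric space and let $\sigma$ be a reversible conical bicombing on $X$. Let $(e,E(X))$ denote the injective hull of $X$. Then there exists a reversible conical bicombing $\bar{\sigma}$ on $E(X)$ such that \[ e(\sigma_{xy}(t))=\bar{\sigma}_{e(x)e(y)}(t) \] for all $(x,y,t)\in X\times X\times[0,1]$.
   Context: A (geodesic) bicombing on a metric space $(X,d)$ is a map $\sigma\colon X\times X\times[0,1]\to X$ such that for every $(x,y)$ the path $\sigma_{xy}(\cdot):=\sigma(x,y,\cdot)$ is a metric geodesic from $x$ to $y$, i.e. $\sigma_{xy}(0)=x$, $\sigma_{xy}(1)=y$ and $d(\sigma_{xy}(s),\sigma_{xy}(t))=|s-t|\,d(x,y)$. It is conical if $d(\sigma_{xy}(t),\sigma_{x'y'}(t))\le (1-t)d(x,x')+t\,d(y,y')$ for all $x,y,x',y'\in X$, $t\in[0,1]$, and reversible if $\sigma_{xy}(t)=\sigma_{yx}(1-t)$ for all $x,y,t$. A metric space $Y$ is injective if for every metric space $B$, subset $A\subset B$ and 1-Lipschitz map $f\colon A\to Y$ there is a 1-Lipschitz extension $\bar f\colon B\to Y$. An injective hull of $X$ is a pair $(e,E(X))$ where $E(X)$ is an injective metric space and $e\colon X\to E(X)$ is an isometric embedding such that any 1-Lipschitz map $f\colon E(X)\to Z$ into a metric space $Z$ is an isometric embedding whenever $f\circ e$ is an isometric embedding. *)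

(* Defs.v *)
From Stdlib Require Import Reals.
Open Scope R_scope.

Definition is_metric {T : Type} (d : T -> T -> R) : Prop :=
  (forall x y, 0 <= d x y) /\
  (forall x y, d x y = 0 <-> x = y) /\
  (forall x y, d x y = d y x) /\
  (forall x y z, d x z <= d x y + d y z).

Definition one_lipschitz {S T : Type} (dS : S -> S -> R) (dT : T -> T -> R)
  (f : S -> T) : Prop :=
  forall a b, dT (f a) (f b) <= dS a b.

Definition isometric_embedding {S T : Type} (dS : S -> S -> R) (dT : T -> T -> R)
  (f : S -> T) : Prop :=
  forall a b, dT (f a) (f b) = dS a b.

Definition injective_metric_space {Y : Type} (dY : Y -> Y -> R) : Prop :=
  forall (B : Type) (dB : B -> B -> R), is_metric dB ->
  forall (A : B -> Prop) (f : {b : B | A b} -> Y),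
    (forall a a' : {b : B | A b}, dY (f a) (f a') <= dB (proj1_sig a) (proj1_sig a')) ->
    exists g : B -> Y, one_lipschitz dB dY g /\
      (forall a : {b : B | A b}, g (proj1_sig a) = f a).

Definition injective_hull {X E : Type} (dX : X -> X -> R) (dE : E -> E -> R)
  (e : X -> E) : Prop :=
  injective_metric_space dE /\
  isometric_embedding dX dE e /\
  (forall (Z : Type) (dZ : Z -> Z -> R), is_metric dZ ->
   forall f : E -> Z, one_lipschitz dE dZ f ->
     isometric_embedding dX dZ (fun x => f (e x)) ->
     isometric_embedding dE dZ f).

Definition in01 (t : R) : Prop := 0 <= t <= 1.

(* A (geodesic) bicombing; sigma x y t only matters for t in [0,1]. *)
Definition bicombing {X : Type} (d : X -> X -> R) (sigma : X -> X -> R -> X) : Prop :=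
  forall x y,
    sigma x y 0 = x /\ sigma x y 1 = y /\
    (forall s t, in01 s -> in01 t ->
       d (sigma x y s) (sigma x y t) = Rabs (s - t) * d x y).

Definition conical {X : Type} (d : X -> X -> R) (sigma : X -> X -> R -> X) : Prop :=
  forall x y x' y' t, in01 t ->
    d (sigma x y t) (sigma x' y' t) <= (1 - t) * d x x' + t * d y y'.

Definition reversible {X : Type} (sigma : X -> X -> R -> X) : Prop :=
  forall x y t, in01 t -> sigma x y t = sigma y x (1 - t).

(* Main.v *)
Require Import Defs.
From Stdlib Require Import Reals Lra ClassicalEpsilon.
From Stdlib Require Import FunctionalExtensionality PropExtensionality ProofIrrelevance.
Open Scope R_scope.

(** Identify a triple [(z, w, t)] of [E * E * R] with the measure
    [(1 - t) delta_z + t delta_w] and use the Wasserstein distance [W], in its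
    Kantorovich dual form.  Reversible conical bicombings are exactly suited to
    this: on triples from [X], the map [(x, y, t) |-> sigma x y t] is
    1-Lipschitz for [W].  Indeed an optimal transport between two two-point
    measures can be taken to use at most three of the four routes, and each
    such plan is realized by two conical moves separated by one move along a
    geodesic.  The distance functions [dE z (e .)], [z] in [E], are extremal,
    hence convex along [sigma], so the map stays 1-Lipschitz when extended by
    [delta_z |-> z].
    Injectivity of [E] extends it to all triples; the three properties of the
    resulting bicombing are upper bounds on [W]. *)

(** * Pseudometrics, their quotients, and maps into injective spaces *)

Definition is_pseudometric {T : Type} (d : T -> T -> R) : Prop :=
  (forall x, d x x = 0) /\
  (forall x y, d x y = d y x) /\
  (forall x y z, d x z <= d x y + d y z).

Lemma pseudometric_ge0 (T : Type) (d : T -> T -> R) :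
  is_pseudometric d -> forall x y, 0 <= d x y.
Proof.
intros (D0 & Dsym & Dtri) x y.
pose proof (Dtri x y x). rewrite D0, (Dsym y x) in H. lra.
Qed.

Lemma metric_pseudometric (T : Type) (d : T -> T -> R) :
  is_metric d -> is_pseudometric d.
Proof.
intros (_ & D0 & Dsym & Dtri). split; [|split]; auto.
intros x. now apply D0.
Qed.

(** Injectivity and the hull property speak of genuine metrics, so points at [rho]-distance 0 must
    be glued. A class is encoded as a predicate, and choice supplies representatives. *)
Lemma metric_quotient (T : Type) (rho : T -> T -> R) :
  is_pseudometric rho ->
  exists (Q : Type) (dQ : Q -> Q -> R) (pi : T -> Q),
    is_metric dQ /\ (forall a b, dQ (pi a) (pi b) = rho a b).
Proof.
intros H. pose proof (pseudometric_ge0 _ _ H) as Dge0.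
destruct H as (D0 & Dsym & Dtri).
set (Q := {c : T -> Prop | exists t, c = (fun u => rho t u = 0)}).
set (rep := fun q : Q =>
  proj1_sig (constructive_indefinite_description _ (proj2_sig q))).
assert (repP : forall q : Q, proj1_sig q = (fun u => rho (rep q) u = 0)).
{ intros q. unfold rep. now destruct constructive_indefinite_description. }
exists Q, (fun p q => rho (rep p) (rep q)),
  (fun t => exist _ (fun u => rho t u = 0) (ex_intro _ t eq_refl)).
split.
- split; [|split; [|split]]; auto.
  intros p q; split; [|intros ->; apply D0].
  intros pq. apply eq_sig_hprop; [intros; apply proof_irrelevance|].
  rewrite !repP. extensionality u. apply propositional_extensionality.
  pose proof (Dtri (rep p) (rep q) u). pose proof (Dtri (rep q) (rep p) u).
  pose proof (Dge0 (rep p) u). pose proof (Dge0 (rep q) u).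
  rewrite (Dsym (rep q) (rep p)) in *. split; lra.
- assert (repK : forall t, rho t (rep (exist _ (fun u => rho t u = 0)
    (ex_intro _ t eq_refl))) = 0).
  { intros t. set (q := exist _ _ _).
    change (proj1_sig q (rep q)). rewrite repP. apply D0. }
  intros a b. pose proof (repK a) as Ha. pose proof (repK b) as Hb.
  set (a' := rep _) in *. set (b' := rep (exist _ (fun u => rho b u = 0) _)) in *.
  pose proof (Dtri a a' b). pose proof (Dtri a' b' b).
  pose proof (Dtri a' a b'). pose proof (Dtri a b b').
  rewrite (Dsym a' a), (Dsym b' b) in *. lra.
Qed.

(** Take the supremum of [Rabs (phi p - phi q)] over [Phi]. It serves both for [W] and for a
    shrunken metric on the hull. *)
Lemma sup_pseudometric (T : Type) (Phi : (T -> R) -> Prop) :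
  (exists phi, Phi phi) ->
  (forall p q, exists M, forall phi, Phi phi -> Rabs (phi p - phi q) <= M) ->
  exists rho : T -> T -> R, is_pseudometric rho /\
    (forall phi p q, Phi phi -> phi p - phi q <= rho p q) /\
    (forall p q M, (forall phi, Phi phi -> Rabs (phi p - phi q) <= M) ->
       rho p q <= M).
Proof.
intros [phi0 H0] bnd.
set (V := fun p q r => exists phi, Phi phi /\ r = Rabs (phi p - phi q)).
assert (lub : forall p q, {m : R | is_lub (V p q) m}).
{ intros p q. apply completeness.
  - destruct (bnd p q) as [M HM]. exists M. intros r (phi & Hphi & ->). auto.
  - exists (Rabs (phi0 p - phi0 q)), phi0. auto. }
set (rho := fun p q => proj1_sig (lub p q)).
assert (ub : forall phi p q, Phi phi -> Rabs (phi p - phi q) <= rho p q).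
{ intros phi p q Hphi. unfold rho. destruct (lub p q) as [m [Hm ?]]; simpl.
  apply Hm. now exists phi. }
assert (le : forall p q M, (forall phi, Phi phi -> Rabs (phi p - phi q) <= M) ->
  rho p q <= M).
{ intros p q M HM. unfold rho. destruct (lub p q) as [m [? Hm]]; simpl.
  apply Hm. intros r (phi & Hphi & ->). auto. }
exists rho. split; [split; [|split]|split].
- intros p. apply Rle_antisym.
  + apply le. intros phi _. rewrite Rminus_diag, Rabs_R0. lra.
  + eapply Rle_trans; [apply Rabs_pos|apply (ub phi0 p p H0)].
- assert (forall p q, rho p q <= rho q p).
  { intros p q. apply le. intros phi Hphi. rewrite Rabs_minus_sym. auto. }
  intros p q. apply Rle_antisym; auto.
- intros p q r. apply le. intros phi Hphi.
  replace (phi p - phi r) with ((phi p - phi q) + (phi q - phi r)) by ring.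
  eapply Rle_trans; [apply Rabs_triang|]. apply Rplus_le_compat; auto.
- intros phi p q Hphi. eapply Rle_trans; [apply Rle_abs|auto].
- exact le.
Qed.

(** The relation [S] is a partial map: by [lip], values prescribed at points at [rho]-distance 0
    coincide, so it descends to a subset of the metric quotient. *)
Lemma injective_extend_relation (Y T : Type) (dY : Y -> Y -> R)
  (rho : T -> T -> R) (S : T -> Y -> Prop) :
  is_metric dY -> injective_metric_space dY -> is_pseudometric rho ->
  (forall p q u v, S p u -> S q v -> dY u v <= rho p q) ->
  exists g : T -> Y, one_lipschitz rho dY g /\ (forall p u, S p u -> g p = u).
Proof.
intros mY inj prho lip.
destruct (metric_quotient _ _ prho) as (Q & dQ & pi & mQ & piE).
set (A := fun q => exists (u : Y) (p : T), pi p = q /\ S p u).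
set (f := fun a : {q | A q} =>
  proj1_sig (constructive_indefinite_description _ (proj2_sig a))).
assert (fP : forall a, exists p, pi p = proj1_sig a /\ S p (f a)).
{ intros a. unfold f. now destruct constructive_indefinite_description. }
destruct (inj Q dQ mQ A f) as (g & glip & gA).
{ intros a a'. destruct (fP a) as (p & <- & Hp). destruct (fP a') as (p' & <- & Hp').
  rewrite piE. auto. }
exists (fun p => g (pi p)). split.
- intros a b. rewrite <- piE. apply glip.
- intros p u Hpu.
  assert (HA : A (pi p)) by (exists u, p; auto).
  pose proof (gA (exist _ _ HA)) as Hg. simpl in Hg. rewrite Hg.
  destruct (fP (exist _ _ HA)) as (p' & Hp' & HS). simpl in Hp'.
  destruct mY as (Yge0 & Y0 & _). apply Y0. apply Rle_antisym; [|apply Yge0].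
  rewrite (lip _ _ _ _ HS Hpu), <- piE, Hp', piE.
  right. apply prho.
Qed.

(** * Minimality of the hull metric and convexity of its distance functions *)

(** The projection to the metric quotient of [rho] is 1-Lipschitz and isometric on [X], hence
    isometric. *)
Lemma hull_pseudometric (X E : Type) (d : X -> X -> R) (dE : E -> E -> R)
  (e : X -> E) (rho : E -> E -> R) :
  injective_hull d dE e -> is_pseudometric rho ->
  (forall z w, rho z w <= dE z w) ->
  (forall x y, rho (e x) (e y) = d x y) ->
  forall z w, rho z w = dE z w.
Proof.
intros (_ & _ & ess) prho le eqX z w.
destruct (metric_quotient _ _ prho) as (Q & dQ & pi & mQ & piE).
rewrite <- piE. apply (ess Q dQ mQ pi).
- intros a b. rewrite piE. auto.
- intros a b. rewrite piE. auto.
Qed.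

(* Otherwise one could shrink the distance between [z] and [e x] to [c] without
   affecting the distances within [X]. *)
Lemma hull_dist_extremal (X E : Type) (d : X -> X -> R) (dE : E -> E -> R)
  (e : X -> E) :
  is_metric d -> is_metric dE -> injective_hull d dE e ->
  forall z x c, 0 <= c -> (forall y, d x y <= c + dE z (e y)) -> dE z (e x) <= c.
Proof.
intros (_ & _ & Xsym & Xtri) mE hull z x c c0 Hc.
pose proof hull as (_ & iso & _). red in iso.
pose proof mE as (Ege0 & _ & Esym & Etri).
destruct (metric_pseudometric _ _ mE) as (E0 & _).
(* This [rho] is the largest pseudometric below [dE] that puts [z] and [e x] within [c]. *)
destruct (sup_pseudometric E (fun phi =>
  (forall a b, phi a - phi b <= dE a b) /\ Rabs (phi z - phi (e x)) <= c))
  as (rho & prho & ge & le).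
{ exists (fun _ => 0). split.
  - intros a b. pose proof (Ege0 a b). lra.
  - rewrite Rminus_diag, Rabs_R0. lra. }
{ intros p q. exists (dE p q). intros phi [Hphi _]. apply Rabs_le.
  pose proof (Hphi p q). pose proof (Hphi q p). rewrite (Esym q p) in *. lra. }
rewrite <- (hull_pseudometric X E d dE e rho hull prho).
- apply le. now intros phi [_ Hphi].
- intros p q. apply le. intros phi [Hphi _]. apply Rabs_le.
  pose proof (Hphi p q). pose proof (Hphi q p). rewrite (Esym q p) in *. lra.
- intros x1 y. apply Rle_antisym.
  + rewrite <- iso. apply le. intros phi [Hphi _]. apply Rabs_le.
    pose proof (Hphi (e x1) (e y)). pose proof (Hphi (e y) (e x1)).
    rewrite (Esym (e y)) in *. lra.
  (* Distance to [e y] when a jump of length [c] from [z] to [e x] is allowed. By [Hc], the jump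
     shortens nothing for points of [X]. *)
  + set (phi := fun u => Rmin (dE u (e y)) (c + d x y + dE u z)).
    assert (phiX : forall w, phi (e w) = d w y).
    { intros w. unfold phi. rewrite iso. apply Rmin_left.
      pose proof (Xtri w x y). pose proof (Hc w).
      rewrite (Esym (e w)), (Xsym w x) in *. lra. }
    assert (phi (e x1) - phi (e y) = d x1 y) as <-.
    { rewrite !phiX, <- (iso y y), E0. ring. }
    apply ge. split.
    * intros a b. unfold phi.
      pose proof (Etri a b (e y)). pose proof (Etri a b z).
      unfold Rmin. repeat destruct Rle_dec; lra.
    * rewrite phiX. unfold phi. rewrite E0. apply Rabs_le.
      pose proof (Hc y). pose proof (Etri z (e x) (e y)).
      unfold Rmin. destruct Rle_dec; lra.
Qed.

(** By extremality it suffices to bound [d (sigma x y t) w] for [w] in [X]: compare with the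
    constant geodesic at [w] by conicality, then pass through [z]. *)
Lemma hull_dist_convex (X E : Type) (d : X -> X -> R) (dE : E -> E -> R)
  (e : X -> E) (sigma : X -> X -> R -> X) :
  is_metric d -> is_metric dE -> bicombing d sigma -> conical d sigma ->
  injective_hull d dE e ->
  forall z x y t, in01 t ->
    dE z (e (sigma x y t)) <= (1 - t) * dE z (e x) + t * dE z (e y).
Proof.
intros mX mE bic con hull z x y t Ht. pose proof Ht as [t0 t1].
pose proof mE as (Ege0 & _ & Esym & Etri).
pose proof mX as (Xge0 & X0 & _).
pose proof hull as (_ & iso & _). red in iso.
apply (hull_dist_extremal X E d dE e mX mE hull).
- pose proof (Ege0 z (e x)). pose proof (Ege0 z (e y)). nra.
- intros w.
  assert (sww : sigma w w t = w).
  { apply X0. destruct (bic w w) as (s0 & _ & geo).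
    pose proof (geo t 0 Ht ltac:(split; lra)) as H. rewrite s0 in H.
    rewrite H. replace (d w w) with 0 by (symmetry; now apply X0). ring. }
  pose proof (con x y w w t Ht) as H. rewrite sww, <- (iso x w), <- (iso y w) in H.
  pose proof (Etri (e x) z (e w)). pose proof (Etri (e y) z (e w)).
  rewrite (Esym (e x) z), (Esym (e y) z) in *. nra.
Qed.

(** * The Lipschitz estimate for triples from [X] *)

Section Wasserstein.

Context (X E : Type) (d : X -> X -> R) (dE : E -> E -> R) (e : X -> E).
Context (sigma : X -> X -> R -> X).
Context (mX : is_metric d) (mE : is_metric dE) (iso : isometric_embedding d dE e).
Context (bic : bicombing d sigma) (con : conical d sigma) (rev : reversible sigma).

Context (W : E * E * R -> E * E * R -> R) (pW : is_pseudometric W).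
Context (W_ge : forall phi : E -> R, (forall a b, phi a - phi b <= dE a b) ->
  forall x y t x' y' s, ((1 - t) * phi x + t * phi y)
    - ((1 - s) * phi x' + s * phi y') <= W (x, y, t) (x', y', s)).
Context (W_rev : forall x y t, W (x, y, t) (y, x, 1 - t) = 0).

(* The plan moves masses [1 - s], [t], [s - t] from [x] to [x'], from [y] to
   [y'], from [x] to [y']; [phi] below is its Kantorovich potential. *)
Lemma bicombing_W_uncrossed_le (x y x' y' : X) (t s : R) :
  in01 t -> in01 s -> t <= s -> d x x' + d y y' <= d x y' + d y x' ->
  d (sigma x y t) (sigma x' y' s) <= W (e x, e y, t) (e x', e y', s).
Proof.
intros Ht Hs ts cyc. pose proof Ht as [t0 t1]. pose proof Hs as [s0 s1].
pose proof mX as (Xge0 & _ & Xsym & Xtri).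
destruct (metric_pseudometric _ _ mX) as (X0 & _).
destruct (metric_pseudometric _ _ mE) as (E0 & _ & Etri).
(* The two terms agree at [e x], and [cyc] makes the first the smaller at [e y]. Hence [phi] drops
   by at least the full distance along each of the three routes. *)
set (phi := fun u => Rmin (dE u (e y')) (dE u (e x') + d x y' - d x x')).
assert (H := W_ge phi).
assert (philip : forall a b, phi a - phi b <= dE a b).
{ intros a b. unfold phi. pose proof (Etri a b (e y')). pose proof (Etri a b (e x')).
  unfold Rmin. repeat destruct Rle_dec; lra. }
specialize (H philip (e x) (e y) t (e x') (e y') s).
assert (phi (e x) = d x y').
{ unfold phi. rewrite !iso. rewrite Rmin_left; lra. }
assert (phi (e y) = d y y').
{ unfold phi. rewrite !iso. rewrite Rmin_left; lra. }
assert (phi (e x') <= d x y' - d x x').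
{ unfold phi. rewrite E0. eapply Rle_trans; [apply Rmin_r|]. lra. }
assert (phi (e y') <= 0).
{ unfold phi. rewrite E0. apply Rmin_l. }
(* Move [y] to [y'] at time [t], slide from [t] to [s] along the geodesic from [x] to [y'], then
   move [x] to [x'] at time [s]: the total is the cost of the plan. *)
pose proof (con x y x y' t Ht) as m1. rewrite X0 in m1.
destruct (bic x y') as (_ & _ & geo). pose proof (geo t s Ht Hs) as m2.
rewrite (Rabs_left1 (t - s)) in m2 by lra.
pose proof (con x y' x' y' s Hs) as m3. rewrite X0 in m3.
pose proof (Xtri (sigma x y t) (sigma x y' t) (sigma x' y' s)).
pose proof (Xtri (sigma x y' t) (sigma x y' s) (sigma x' y' s)).
nra.
Qed.

Lemma W_swap (x y : E) (t : R) (p : E * E * R) : W (x, y, t) p = W (y, x, 1 - t) p.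
Proof.
destruct pW as (_ & Wsym & Wtri).
pose proof (Wtri (x, y, t) (y, x, 1 - t) p).
pose proof (Wtri (y, x, 1 - t) (x, y, t) p).
rewrite (Wsym (y, x, 1 - t) (x, y, t)), W_rev in *. lra.
Qed.

(** Two symmetries reduce to the previous case: reversing both triples flips the order of [t] and
    [s] and keeps the pairing, while reversing only the second exchanges [x'] and [y']. *)
Lemma bicombing_W_le (x y x' y' : X) (t s : R) :
  in01 t -> in01 s ->
  d (sigma x y t) (sigma x' y' s) <= W (e x, e y, t) (e x', e y', s).
Proof.
assert (in01C : forall r, in01 r -> in01 (1 - r)) by (unfold in01; intros; lra).
assert (uncrossed : forall x y x' y' t s, in01 t -> in01 s ->
  d x x' + d y y' <= d x y' + d y x' ->
  d (sigma x y t) (sigma x' y' s) <= W (e x, e y, t) (e x', e y', s)).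
{ clear x y x' y' t s. intros x y x' y' t s Ht Hs cyc.
  destruct (Rle_or_lt t s).
  - now apply bicombing_W_uncrossed_le.
  - rewrite (rev x y), (rev x' y') by assumption.
    rewrite W_swap. destruct pW as (_ & Wsym & _).
    rewrite Wsym, W_swap. rewrite Wsym.
    apply bicombing_W_uncrossed_le; auto; lra. }
intros Ht Hs. destruct (Rle_or_lt (d x x' + d y y') (d x y' + d y x')).
- now apply uncrossed.
- rewrite (rev x' y') by assumption. destruct pW as (_ & Wsym & _).
  rewrite Wsym, W_swap. rewrite Wsym.
  apply uncrossed; auto; lra.
Qed.

End Wasserstein.

(** * The bicombing on the hull *)

Theorem theorem1p1 (X : Type) (d : X -> X -> R) (E : Type) (dE : E -> E -> R)
  (e : X -> E) (sigma : X -> X -> R -> X) :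
  is_metric d -> is_metric dE ->
  bicombing d sigma -> conical d sigma -> reversible sigma ->
  injective_hull d dE e ->
  exists sigmabar : E -> E -> R -> E,
    bicombing dE sigmabar /\ conical dE sigmabar /\ reversible sigmabar /\
    (forall x y t, in01 t -> e (sigma x y t) = sigmabar (e x) (e y) t).
Proof.
intros mX mE bic con rev hull.
pose proof hull as (inj & iso & _).
pose proof mE as (Ege0 & Eeq & Esym & Etri).
destruct (metric_pseudometric _ _ mE) as (E0 & _).
(* Integrals of 1-Lipschitz functions against [(1 - t) delta_x + t delta_y]. The formula is kept for
   every real [t], whence the absolute values in the bound below. *)
set (Phi := fun psi : E * E * R -> R => exists phi : E -> R,
  (forall a b, phi a - phi b <= dE a b) /\
  psi = fun p => (1 - snd p) * phi (fst (fst p)) + snd p * phi (snd (fst p))).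
assert (lipabs : forall phi : E -> R, (forall a b, phi a - phi b <= dE a b) ->
  forall a b, Rabs (phi a - phi b) <= dE a b).
{ intros phi Hphi a b. apply Rabs_le.
  pose proof (Hphi a b). pose proof (Hphi b a). rewrite (Esym b a) in *. lra. }
destruct (sup_pseudometric (E * E * R) Phi) as (W & pW & ge & le).
{ exists (fun p => (1 - snd p) * 0 + snd p * 0), (fun _ => 0). split; [|reflexivity].
  intros a b. pose proof (Ege0 a b). lra. }
{ intros [[x y] t] [[x' y'] s].
  exists (dE x x' + Rabs t * dE y x + Rabs s * dE x' y').
  intros psi (phi & Hphi & ->). simpl. specialize (lipabs phi Hphi).
  replace (_ - _) with ((phi x - phi x') + t * (phi y - phi x) + s * (phi x' - phi y'))
    by ring.
  eapply Rle_trans; [apply Rabs_triang|]. apply Rplus_le_compat.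
  - eapply Rle_trans; [apply Rabs_triang|]. apply Rplus_le_compat; auto.
    rewrite Rabs_mult. apply Rmult_le_compat_l; auto using Rabs_pos.
  - rewrite Rabs_mult. apply Rmult_le_compat_l; auto using Rabs_pos. }
assert (W_ge : forall phi : E -> R, (forall a b, phi a - phi b <= dE a b) ->
  forall x y t x' y' s, ((1 - t) * phi x + t * phi y)
    - ((1 - s) * phi x' + s * phi y') <= W (x, y, t) (x', y', s)).
{ intros phi Hphi x y t x' y' s.
  apply (ge (fun p => (1 - snd p) * phi (fst (fst p)) + snd p * phi (snd (fst p)))
    (x, y, t) (x', y', s)).
  now exists phi. }
assert (W_rev : forall x y t, W (x, y, t) (y, x, 1 - t) = 0).
{ intros x y t. apply Rle_antisym; [|now apply pseudometric_ge0].
  apply le. intros psi (phi & _ & ->). simpl.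
  replace (_ - _) with 0 by ring. rewrite Rabs_R0. lra. }
assert (W_dirac : forall x y t z s,
  (1 - t) * dE z x + t * dE z y <= W (z, z, s) (x, y, t)).
{ intros x y t z s. destruct pW as (_ & Wsym & _). rewrite Wsym.
  pose proof (W_ge (dE z)) as H.
  assert (Hz : forall a b, dE z a - dE z b <= dE a b).
  { intros a b. pose proof (Etri z b a). rewrite (Esym b a) in *. lra. }
  specialize (H Hz x y t z z s). rewrite E0 in H. lra. }
(* The prescribed values. Of the four Lipschitz cases, [X] against [X] is the transport estimate,
   and the mixed ones combine [W_dirac] with convexity. *)
set (S := fun (p : E * E * R) (u : E) =>
  (exists x y t, in01 t /\ p = (e x, e y, t) /\ u = e (sigma x y t)) \/
  (exists z t, p = (z, z, t) /\ u = z)).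
destruct (injective_extend_relation E _ dE W S mE inj pW) as (g & glip & gS).
{ pose proof pW as (_ & Wsym & _).
  intros p q u v [(x & y & t & Ht & -> & ->)|(z & t & -> & ->)]
    [(x' & y' & s & Hs & -> & ->)|(w & s & -> & ->)].
  - rewrite iso. now apply bicombing_W_le with dE.
  - rewrite Esym, Wsym. eapply Rle_trans; [|apply W_dirac].
    now apply (hull_dist_convex X E d dE e).
  - eapply Rle_trans; [|apply W_dirac].
    now apply (hull_dist_convex X E d dE e).
  - eapply Rle_trans; [|apply W_dirac]. lra. }
assert (g_dirac : forall z t, g (z, z, t) = z).
{ intros z t. apply gS. right. now exists z, t. }
assert (g_con : forall x y x' y' t, in01 t ->
  dE (g (x, y, t)) (g (x', y', t)) <= (1 - t) * dE x x' + t * dE y y').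
{ intros x y x' y' t [t0 t1]. eapply Rle_trans; [apply glip|].
  apply le. intros psi (phi & Hphi & ->). simpl. specialize (lipabs phi Hphi).
  replace (_ - _) with ((1 - t) * (phi x - phi x') + t * (phi y - phi y')) by ring.
  eapply Rle_trans; [apply Rabs_triang|].
  rewrite !Rabs_mult, (Rabs_right t), (Rabs_right (1 - t)) by lra.
  apply Rplus_le_compat; apply Rmult_le_compat_l; auto; lra. }
(* Endpoints follow by comparison with a Dirac triple, whose image is known. *)
assert (g_0 : forall x y, g (x, y, 0) = x).
{ intros x y. apply Eeq, Rle_antisym; [|apply Ege0].
  pose proof (g_con x y x x 0) as H. rewrite g_dirac, E0 in H.
  specialize (H ltac:(split; lra)). lra. }
assert (g_1 : forall x y, g (x, y, 1) = y).
{ intros x y. apply Eeq, Rle_antisym; [|apply Ege0].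
  pose proof (g_con x y y y 1) as H. rewrite g_dirac, E0 in H.
  specialize (H ltac:(split; lra)). lra. }
assert (g_lip : forall x y s t,
  dE (g (x, y, s)) (g (x, y, t)) <= Rabs (s - t) * dE x y).
{ intros x y s t. eapply Rle_trans; [apply glip|].
  apply le. intros psi (phi & Hphi & ->). simpl.
  replace (_ - _) with ((s - t) * (phi y - phi x)) by ring.
  rewrite Rabs_mult, Rabs_minus_sym with (x := phi y).
  apply Rmult_le_compat_l; auto using Rabs_pos. }
(* The upper bounds on the three pieces add up to [dE x y], so by the triangle inequality the middle
   one is attained. *)
assert (g_geo : forall x y s t, in01 s -> in01 t -> s <= t ->
  dE (g (x, y, s)) (g (x, y, t)) = Rabs (s - t) * dE x y).
{ intros x y s t [s0 s1] [t0 t1] st. apply Rle_antisym; [apply g_lip|].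
  pose proof (g_lip x y 0 s) as H0. pose proof (g_lip x y t 1) as H1.
  rewrite g_0 in H0. rewrite g_1 in H1.
  rewrite Rabs_left1 in H0, H1 |- * by lra.
  pose proof (Etri x (g (x, y, s)) y). pose proof (Etri (g (x, y, s)) (g (x, y, t)) y).
  lra. }
exists (fun x y t => g (x, y, t)). split; [|split; [|split]].
- intros x y. split; [apply g_0|]. split; [apply g_1|].
  intros s t Hs Ht. destruct (Rle_or_lt s t).
  + auto.
  + rewrite Esym, Rabs_minus_sym. apply g_geo; auto; lra.
- exact g_con.
(* Reversed triples are at [W]-distance 0, so the 1-Lipschitz [g] identifies them. *)
- intros x y t _. apply Eeq, Rle_antisym; [|apply Ege0].
  rewrite <- (W_rev x y t). apply glip.
- intros x y t Ht. symmetry. apply gS. left. exists x, y, t. auto.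
Qed.
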